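(* Let $f(x)=x^d+a_{d-1}x^{d-1}+\dots+a_1x+a_0\in\mathbb{Z}[x]$, where $a_0,\dots,a_{d-1}$ are independent integer-valued random variables, and let $H$ be a positive integer. Suppose that for some $h$ with $1\le h\le d-1$ and $\gcd(h,d)=1$, $a_h$ is uniformly distributed in an arbitrary finite set of integers of size at least $H$, while the remaining $a_j$ for $j\ne h$ have arbitrary distributions. Then $$\mathbb{P}(f(x)\text{ is irreducible over }\mathbb{Z})\ \ge\ 1-\mathbb{P}(a_0=0)-\frac{2d2^d\,\mathbb{E}[\tau(a_0)I(a_0\neq 0)]}{H}.$$ Furthermore, the same conclusion holds if, instead, for some subset $I_0$ of $\{1,\dots,d-1\}$ with $\gcd(\{d\}\cup I_0)=1$, each $a_i$ with $i\in I_0$ is uniformly distributed in an arbitrary finite set of integers of size at least $H$, the remaining $a_j$ for $j\notin I_0$ have arbitrary distributions, and $a_0,a_1,\dots,a_{d-1}$ are independent.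
   Context: For a nonzero integer $n$, $\tau(n)$ denotes the number of positive divisors of $n$. $I(\cdot)$ denotes the indicator function of an event. If the expectation is infinite, the bound is vacuous. A monic integer polynomial of positive degree is irreducible over $\mathbb{Z}$ if it is not a product of two polynomials in $\mathbb{Z}[x]$ of positive degree. *)

(* Defs.v *)
From HB Require Import structures.
From mathcomp Require Import all_boot all_order all_algebra finmap.
From mathcomp Require Import all_classical all_reals all_analysis.

Set Implicit Arguments.
Unset Strict Implicit.
Unset Printing Implicit Defensive.

Import Order.TTheory GRing.Theory Num.Theory.
Import numFieldNormedType.Exports.

Local Open Scope classical_set_scope.
Local Open Scope ring_scope.

HB.instance Definition _ := isPointed.Build int 0.

(* Every set of integers is measurable, as the library already has it for nat;
   an integer-valued random variable is then an element of {RV P >-> int}. *)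
HB.instance Definition _ := @isMeasurable.Build default_measure_display
  int discrete_measurable discrete_measurable0
  discrete_measurableC discrete_measurableU.

Definition mutually_independent (disp disp' : measure_display)
    (T : measurableType disp) (T' : measurableType disp') (R : realType)
    (P : probability T R) (I : finType) (X : I -> {RV P >-> T'}) : Prop :=
  forall (J : {set I}) (B : I -> set T'),
    (forall i, measurable (B i)) ->
    P (\bigcap_(i in [set` J]) X i @^-1` B i)
      = (\prod_(i in J) P (X i @^-1` B i))%E.

Definition uniform_on (disp : measure_display) (T : measurableType disp)
    (R : realType) (P : probability T R) (S : {fset int})
    (X : {RV P >-> int}) : Prop :=
  forall k : int,
    distribution P X [set k] = (if k \in S then #|` S|%:R^-1 else 0)%:E.

Definition uniform_on_large_set (disp : measure_display)
    (T : measurableType disp) (R : realType) (P : probability T R) (H : nat)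
    (X : {RV P >-> int}) : Prop :=
  exists2 S : {fset int}, (H <= #|` S|)%N & uniform_on S X.

(* Irreducibility over Z of a monic polynomial. Without monicity it would
   differ from irreducibility in the ring Z[x], since constant factors are
   ignored. *)
Definition irreducibleZ (f : {poly int}) : Prop :=
  (1 < size f)%N /\
  ~ exists g h : {poly int}, [/\ (1 < size g)%N, (1 < size h)%N & f = g * h].

Definition monic_poly (d : nat) (c : 'I_d -> int) : {poly int} :=
  'X^d + \sum_(i < d) c i *: 'X^i.

(* Only used for n != 0 (tau 0 = 0 here). *)
Definition tau (n : int) : nat := size (divisors `|n|%N).

(* Main.v *)
(* Fix every coefficient of f except a_i = y, and let 0 < k < d with d not
   dividing k i. The product over the k-subsets S of the roots of f of
   (c - product of S) is symmetric in the roots, hence a polynomial q in y of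
   degree at most k C(d, k), and q vanishes whenever f has a monic factor of
   degree k whose roots multiply to c. For y large, d - i roots have size about
   y^(1/(d-i)) and i roots size about y^(-1/i), so a k-subset with j large and
   l small roots has product about y^(j/(d-i) - l/i); as the exponent is zero
   only if d | k i, q is not the zero polynomial. The constant term of a factor
   is one of the 2 tau(a_0) signed divisors of a_0, so, given the other
   coefficients, at most 2 tau(a_0) k C(d, k) values of y produce a factor of
   degree k. Since gcd(d, I_0) = 1, each k has a suitable i in I_0, and
   the sum over k of k C(d, k) is at most d 2^d. *)

Require Import Defs.
From HB Require Import structures.
From mathcomp Require Import all_boot all_order all_algebra finmap.
From mathcomp Require Import all_classical all_reals all_analysis.
From mathcomp Require Import measurable_realfun perm complex zify ring lra.
From mathcomp Require Import -(notations) mpoly.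

Set Implicit Arguments.
Unset Strict Implicit.
Unset Printing Implicit Defensive.

Import Order.TTheory GRing.Theory Num.Theory.
Import numFieldNormedType.Exports.
Import ComplexField.Normc.

Local Open Scope classical_set_scope.
Local Open Scope ring_scope.

Lemma horner_mmap_polyC (R : idomainType) n (t : mpoly n R)
    (h : 'I_n -> {poly R}) y :
  (mmap polyC h t).[y] = meval (fun i => (h i).[y]) t.
Proof.
rewrite /meval /mmap horner_sum; apply: eq_bigr => m _.
rewrite hornerCM /mmap1 horner_prod; congr (_ * _).
by apply: eq_bigr => i _; rewrite horner_exp.
Qed.

Lemma size_mmap_polyC (R : idomainType) n (t : mpoly n R)
    (h : 'I_n -> {poly R}) :
  (forall i, size (h i) <= 2)%N -> (size (mmap polyC h t) <= msize t)%N.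
Proof.
move=> hs; apply/leq_sizeP => j tj; rewrite /mmap big_seq coef_sum.
apply: big1 => m mt; rewrite coefCM nth_default ?mulr0 //.
apply: leq_trans tj; apply: leq_trans (msize_mdeg_lt mt).
rewrite mdegE /mmap1; elim/big_rec2: _ => [|i q k _ qk]; first by rewrite size_poly1.
apply: leq_trans (size_polyMleq _ _) _.
have: (size (h i ^+ m i) <= (m i).+1)%N.
  apply: leq_trans (size_poly_exp_leq _ _) _; rewrite ltnS.
  by have := hs i; case: (size _) => [|[|[|]]] //= _; rewrite ?mul0n ?mul1n.
move=> sx; rewrite -subn1 leq_subLR.
have -> : (1 + (m i + k).+1 = (m i).+1 + k.+1)%N by rewrite !addnS.
exact: leq_add.
Qed.

(* Applied with one of the [c i] equal to ['X] and the others constant: a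
   symmetric function of the roots is then a polynomial in that coefficient. *)
Lemma symmetric_root_poly (R : idomainType) n (p : mpoly n R)
    (c : 'I_n -> {poly R}) :
  p \is symmetric -> (forall i, size (c i) <= 2)%N ->
  exists2 q : {poly R}, (size q <= msize p)%N &
    forall y (rs : n.-tuple R),
      (forall i : 'I_n, (\prod_(r <- rs) ('X - r%:P))`_i = (c i).[y]) ->
      meval (tnth rs) p = q.[y].
Proof.
move=> psym cs; have [t [tp tw]] := sym_fundamental psym.
pose h (j : 'I_n) := (-1) ^+ j.+1 *: c (rev_ord j).
exists (mmap polyC h t).
  apply: leq_trans tw; apply: leq_trans (leq_msize_meight t).
  apply: size_mmap_polyC => i; apply: leq_trans (size_scale_leq _ _) (cs _).
move=> y rs hrs; rewrite horner_mmap_polyC -[p in LHS]tp comp_mpoly_meval.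
apply: meval_eq => j; rewrite tnth_mktuple /h hornerZ -hrs.
have -> : val (rev_ord j) = (n - j.+1)%N by [].
rewrite (mroots_coeff rs (lift ord0 j)) mulrA -exprD addnn -mul2n exprM.
by rewrite sqrrN !expr1n mul1r.
Qed.

Definition subset_prod_mpoly (R : idomainType) n k (c : R) : mpoly n R :=
  \prod_(S : {set 'I_n} | #|S| == k) (mpolyC n c - mpolyX R (mesym1 S)).

Lemma subset_prod_mpoly_sym (R : idomainType) n k (c : R) :
  subset_prod_mpoly n k c \is symmetric.
Proof.
apply/issymP => s; rewrite /subset_prod_mpoly rmorph_prod /=.
have msymC : msym s (mpolyC n c) = mpolyC n c.
  by rewrite -[mpolyC n c]mulr1 mul_mpolyC msymZ msym1.
under eq_bigr => S _ do rewrite msymB msymC msymX.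
rewrite [RHS](reindex_inj (imset_inj (@perm_inj _ s))) /=.
apply: eq_big => [S|S _]; first by rewrite card_imset //; apply: perm_inj.
congr (_ - mpolyX _ _); apply/mnmP => i; rewrite !mnmE.
by rewrite -[in RHS](permKV s i) mem_imset //; apply: perm_inj.
Qed.

Lemma msize_subset_prod_mpoly (R : idomainType) n k (c : R) :
  (msize (subset_prod_mpoly n k c) <= (k * 'C(n, k)).+1)%N.
Proof.
have -> : (k * 'C(n, k) = \sum_(S : {set 'I_n} | #|S| == k) k)%N.
  rewrite sum_nat_const mulnC -[in LHS](card_ord n) -card_draws.
  by congr (_ * _)%N; apply: eq_card => S; rewrite !inE.
rewrite /subset_prod_mpoly; elim/big_rec2: _ => [|S N q /eqP Sk IH].
  by rewrite msize1.
have sf : (msize (mpolyC n c - mpolyX R (mesym1 S)) <= k.+1)%N.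
  apply: leq_trans (mmeasureD_le _ _ _) _.
  by rewrite mmeasureN msizeX mdeg_mesym1 Sk mmeasureC geq_max leqnn andbT; case: eqP.
have [->|f0] := eqVneq (mpolyC n c - mpolyX R (mesym1 S)) 0.
  by rewrite mul0r msize0.
have [->|q0] := eqVneq q 0; first by rewrite mulr0 msize0.
by rewrite msizeM //; lia.
Qed.

Lemma meval_subset_prod_mpoly (R : idomainType) n k (c : R) v :
  meval v (subset_prod_mpoly n k c) =
  \prod_(S : {set 'I_n} | #|S| == k) (c - \prod_(i in S) v i).
Proof.
rewrite /subset_prod_mpoly rmorph_prod; apply: eq_bigr => S _ /=.
rewrite mevalB mevalC mevalX; congr (_ - _); rewrite [RHS]big_mkcond.
by apply: eq_bigr => i _; rewrite mnmE; case: ifP.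
Qed.

(* For the absolute value [r] of a root and a coefficient of size [M] at degree
   [i], the hypotheses are what the triangle inequality gives; [r ^+ (i * (d - i))]
   is compared with [M ^+ i] for large roots and with [M ^- (d - i)] for small
   ones, which avoids fractional exponents. *)
Lemma root_size_dichotomy (R : realFieldType) (d i : nat) (L M r : R) :
  (0 < i < d)%N -> 1 <= L -> (2 * L) ^+ d <= M -> 0 <= r ->
  (1 <= r -> M * r ^+ i <= L * r ^+ d) ->
  (1 <= r -> r ^+ d <= M * r ^+ i + L * r ^+ d.-1) ->
  (r <= 1 -> M * r ^+ i <= L) ->
  (r <= 1 -> 1 <= M * r ^+ i + L * r) ->
  let C := (2 * L) ^+ d in let b := r ^+ (i * (d - i)) in
  (M ^+ i <= C * b /\ b <= C * M ^+ i) \/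
  (M ^+ (d - i) * b <= C /\ 1 <= C * (M ^+ (d - i) * b)).
Proof.
move=> /andP[i0 id] L1 LM r0 h1 h2 h3 h4 C b.
have L0 : 0 < L by lra.
have L2 : 1 <= 2 * L by lra.
have C1 m : (m <= d)%N -> (2 * L) ^+ m <= C by move=> md; rewrite ler_weXn2l.
have M0 : 0 < M by apply: lt_le_trans LM; rewrite exprn_gt0 //; lra.
have bE1 : b = (r ^+ (d - i)) ^+ i by rewrite /b mulnC exprM.
have bE2 : b = (r ^+ i) ^+ (d - i) by rewrite /b exprM.
have dE : d = (d - i + i)%N by rewrite subnK // ltnW.
have d1 : (0 < d)%N by apply: leq_ltn_trans id.
have [r1|r1] := leP 1 r; [left|right].
- have rp m : 0 < r ^+ m by rewrite exprn_gt0 //; lra.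
  split.
    have : M <= L * r ^+ (d - i).
      by have := h1 r1; rewrite [in r ^+ d]dE exprD mulrA ler_pM2r.
    move=> /(lerXn2r i); rewrite !nnegrE => /(_ (ltW M0)).
    rewrite exprMn -bE1 => /(_ _)/le_trans; apply; first by rewrite mulr_ge0 // ltW.
    rewrite ler_wpM2r //; first by rewrite /b ltW.
    apply: le_trans (C1 i (ltnW id)); apply: lerXn2r; rewrite ?nnegrE; lra.
  have : r ^+ (d - i) <= 2 * L * M.
    have [r2|r2] := leP r (2 * L).
      apply: le_trans (_ : M <= _); last by rewrite ler_peMl // ltW.
      apply: le_trans LM; apply: le_trans (C1 (d - i)%N (leq_subr _ _)).
      by apply: lerXn2r; rewrite ?nnegrE; lra.
    have h : r ^+ d <= 2 * M * r ^+ i.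
      have E : r ^+ d = r * r ^+ d.-1 by rewrite -exprS prednK.
      have : 2 * L * r ^+ d.-1 <= r ^+ d by rewrite E ler_pM2r // ltW.
      by have := h2 r1; move: (r ^+ d) (r ^+ d.-1) (r ^+ i) => x y z; lra.
    have : r ^+ (d - i) <= 2 * M by move: h; rewrite [in r ^+ d]dE exprD ler_pM2r.
    move=> /le_trans; apply; rewrite mulrAC ler_peMr //; lra.
  move=> /(lerXn2r i); rewrite !nnegrE => /(_ (ltW (rp _))).
  rewrite -bE1 exprMn => /(_ _)/le_trans; apply; first by rewrite mulr_ge0 // ltW //; lra.
  by rewrite ler_wpM2r ?(C1 i (ltnW id)) // exprn_ge0 // ltW.
- have h3' := h3 (ltW r1); have h4' := h4 (ltW r1).
  have ri0 : 0 <= r ^+ i by rewrite exprn_ge0.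
  rewrite bE2 -exprMn; split.
    apply: le_trans (C1 (d - i)%N (leq_subr _ _)); apply: lerXn2r; rewrite ?nnegrE; try lra.
    by rewrite mulr_ge0 // ltW.
  have rL : L * r <= 2^-1.
    suff h : r <= (2 * L)^-1.
      apply: le_trans (ler_wpM2l (ltW L0) h) _.
      by rewrite invfM mulrCA divff ?gt_eqF // mulr1.
    rewrite -(ler_pXn2r i0) ?nnegrE //; last by rewrite invr_ge0; lra.
    rewrite exprVn -[X in _ <= X]mul1r ler_pdivlMr ?exprn_gt0 //; last by lra.
    rewrite -(ler_pM2l M0) mulrA mulr1.
    apply: le_trans (_ : L * (2 * L) ^+ i <= _).
      by rewrite ler_wpM2r // exprn_ge0 //; lra.
    apply: le_trans LM; apply: le_trans (C1 i.+1 id); rewrite exprS.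
    by rewrite ler_wpM2r ?exprn_ge0 //; lra.
  have : 1 <= 2 * L * (M * r ^+ i).
    have x0 : 0 <= M * r ^+ i by rewrite mulr_ge0 // ltW.
    move: h4' rL (ler_peMl x0 L1); rewrite -[2 * L * _]mulrA.
    by move: (M * r ^+ i) (L * r) => x y; move: (L * x) => z; lra.
  move=> /(lerXn2r (d - i)); rewrite !nnegrE => /(_ ler01).
  rewrite expr1n [(2 * L * _) ^+ _]exprMn => /(_ _)/le_trans; apply.
    by rewrite !mulr_ge0 //; lra.
  rewrite ler_wpM2r ?C1 ?leq_subr // exprn_ge0 // mulr_ge0 //; lra.
Qed.

Lemma root_products_ratio (R : realFieldType) (C P Q : R) (s : seq R) :
  0 < C -> 0 < P -> 0 < Q -> all (>= 0) s ->
  {in s, forall b, (P <= C * b /\ b <= C * P) \/ (Q * b <= C /\ 1 <= C * (Q * b))} ->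
  exists j l, [/\ (j + l)%N = size s,
    P ^+ j <= C ^+ size s * (Q ^+ l * \prod_(b <- s) b) &
    Q ^+ l * \prod_(b <- s) b <= C ^+ size s * P ^+ j].
Proof.
move=> C0 P0 Q0; elim: s => [|b s IH] /=.
  by move=> _ _; exists 0, 0; rewrite big_nil !expr0 !mul1r; split.
move=> /andP[b0 s0] hs.
have [|j [l [jl h1 h2]]] := IH s0; first by move=> x xs; apply: hs; rewrite in_cons xs orbT.
have prod0 : 0 <= \prod_(x <- s) x.
  by rewrite big_seq; apply: prodr_ge0 => x /(allP s0).
rewrite big_cons; set B := \prod_(x <- s) x in h1 h2 prod0 *.
have QB0 : 0 <= Q ^+ l * B by rewrite mulr_ge0 // exprn_ge0 // ltW.
have CP0 : 0 <= C ^+ size s * P ^+ j by rewrite mulr_ge0 // exprn_ge0 // ltW.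
have [|[g1 g2]|[g1 g2]] := hs b; first by rewrite in_cons eqxx.
- exists j.+1, l; rewrite addSn jl !exprS; split=> //.
    rewrite (_ : C * _ * _ = (C * b) * (C ^+ size s * (Q ^+ l * B))); last by ring.
    by apply: ler_pM => //; rewrite ?exprn_ge0 ?ltW.
  rewrite (_ : Q ^+ l * _ = b * (Q ^+ l * B)); last by ring.
  rewrite (_ : C * _ * _ = (C * P) * (C ^+ size s * P ^+ j)); last by ring.
  by apply: ler_pM.
- exists j, l.+1; rewrite addnS jl !exprS; split=> //.
    rewrite (_ : C * _ * _ = (C * (Q * b)) * (C ^+ size s * (Q ^+ l * B))); last by ring.
    by rewrite -[leLHS]mul1r; apply: ler_pM => //; rewrite ?exprn_ge0 ?ltW.
  rewrite (_ : Q * _ * _ = (Q * b) * (Q ^+ l * B)); last by ring.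
  rewrite (_ : C * _ * _ = C * (C ^+ size s * P ^+ j)); last by ring.
  by apply: ler_pM => //; rewrite mulr_ge0 // ltW.
Qed.

Lemma normc_ge0 (R : rcfType) (x : R[i]) : 0 <= normc x.
Proof. by case: x => a b; rewrite /normc sqrtr_ge0. Qed.

Lemma normc_exp (R : rcfType) (x : R[i]) n : normc (x ^+ n) = normc x ^+ n.
Proof. by elim: n => [|n IH]; rewrite ?normc1 // !exprS normcM IH. Qed.

Lemma normc_prod (R : rcfType) (s : seq R[i]) :
  normc (\prod_(x <- s) x) = \prod_(x <- s) normc x.
Proof. by elim: s => [|x s IH]; rewrite ?big_nil ?normc1 // !big_cons normcM IH. Qed.

Lemma ler_normc_sum (R : rcfType) (I : Type) (s : seq I) (p : pred I)
    (f : I -> R[i]) :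
  normc (\sum_(j <- s | p j) f j) <= \sum_(j <- s | p j) normc (f j).
Proof.
elim/big_rec2: _ => [|j x z _ h]; first by rewrite normc0.
by apply: le_trans (le_normcD _ _) _; rewrite lerD2l.
Qed.

Lemma normc_int (R : rcfType) (m : int) : normc (m%:~R : R[i]) = `|m|%:~R.
Proof.
rewrite -(rmorph_int (real_complex R)) /= expr0n addr0 sqrtr_sqr.
by rewrite -intr_norm.
Qed.

Definition set_coef d (a : 'I_d -> int) (i : 'I_d) (y : int) : 'I_d -> int :=
  fun j => if j == i then y else a j.

Lemma root_set_coef (F : fieldType) d (a : 'I_d -> int) (i : 'I_d) y (x : F) :
  root (map_poly intr (monic_poly (set_coef a i y))) x ->
  x ^+ d + \sum_(j < d | j != i) (a j)%:~R * x ^+ j + y%:~R * x ^+ i = 0.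
Proof.
rewrite /monic_poly rmorphD /= rmorph_sum /= map_polyXn => /eqP.
rewrite hornerD hornerXn horner_sum (bigD1 i) //= => h.
rewrite -[RHS]h -addrA [in RHS]addrA -[in RHS]addrA; congr (_ + _).
rewrite addrC; congr (_ + _).
  by rewrite /set_coef eqxx map_polyZ /= map_polyXn hornerZ hornerXn.
apply: eq_bigr => j ji.
by rewrite /set_coef (negbTE ji) map_polyZ /= map_polyXn hornerZ hornerXn.
Qed.

Lemma root_set_coef_size (R : rcfType) d (d_gt0 : (0 < d)%N)
    (a : 'I_d -> int) (i : 'I_d) (y : nat) (x : R[i]) :
  (0 < i)%N -> a (Ordinal d_gt0) != 0 ->
  root (map_poly intr (monic_poly (set_coef a i y))) x ->
  let L : R := 1 + \sum_(j < d) `|a j|%:~R in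
  let C := (2 * L) ^+ d in let b := normc x ^+ (i * (d - i)) in
  C <= y%:R ->
  (y%:R ^+ i <= C * b /\ b <= C * y%:R ^+ i) \/
  (y%:R ^+ (d - i) * b <= C /\ 1 <= C * (y%:R ^+ (d - i) * b)).
Proof.
move=> i0 a0 /root_set_coef eq0 L C b Cy.
set r := normc x in b *; have r0 : 0 <= r by apply: normc_ge0.
have rX n : 0 <= r ^+ n by rewrite exprn_ge0.
pose A : R := \sum_(j < d) `|a j|%:~R.
have A0 : 0 <= A by apply: sumr_ge0 => j _; rewrite ler0z.
have yE : normc (y%:~R * x ^+ i) = y%:R * r ^+ i.
  by rewrite normcM normc_int normc_exp.
have leA (p : pred 'I_d) (e : R) : (forall j, p j -> r ^+ j <= e) -> 0 <= e ->
    normc (\sum_(j < d | p j) (a j)%:~R * x ^+ j) <= A * e.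
  move=> he e0; apply: le_trans (ler_normc_sum _ _ _) _.
  rewrite /A mulr_suml [leRHS](bigID p) /= -[leLHS]addr0; apply: lerD.
    apply: ler_sum => j pj; rewrite normcM normc_int normc_exp.
    by rewrite ler_wpM2l ?he // ler0z.
  by apply: sumr_ge0 => j _; rewrite mulr_ge0 // ler0z.
have d1 : d = d.-1.+1 by rewrite prednK.
have hy e : normc (\sum_(j < d | j != i) (a j)%:~R * x ^+ j) <= e ->
    y%:R * r ^+ i <= r ^+ d + e.
  move=> he; rewrite -yE -normcN.
  have -> : - (y%:~R * x ^+ i) = x ^+ d + \sum_(j < d | j != i) (a j)%:~R * x ^+ j.
    by apply/eqP; rewrite eq_sym -addr_eq0 eq0.
  by apply: le_trans (le_normcD _ _) _; rewrite normc_exp lerD2l.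
apply: root_size_dichotomy => //.
- by rewrite i0 ltn_ord.
- by rewrite lerDl.
- move=> r1; apply: le_trans (hy (A * r ^+ d) _) _.
    by apply: leA => // j _; apply: ler_weXn2l => //; apply: ltnW.
  by rewrite /L mulrDl mul1r.
- move=> r1; rewrite -normc_exp.
  have -> : x ^+ d = - (y%:~R * x ^+ i) - \sum_(j < d | j != i) (a j)%:~R * x ^+ j.
    by apply/eqP; rewrite -opprD [X in - X]addrC -addr_eq0 addrA eq0.
  apply: le_trans (le_normcD _ _) _; rewrite !normcN yE lerD2l.
  apply: le_trans (leA _ (r ^+ d.-1) _ _) _ => //.
    by move=> j _; apply: ler_weXn2l => //; rewrite -ltnS -d1.
  by rewrite ler_wpM2r // /L -/A lerDr.
- move=> r1; apply: le_trans (hy (A * 1) _) _.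
    by apply: leA => // j _; apply: exprn_ile1.
  by rewrite mulr1 lerD2r; apply: exprn_ile1.
- move=> r1.
  pose o := Ordinal d_gt0.
  have oi : o != i by apply: contraTneq i0 => <-.
  have rXr n : (0 < n)%N -> r ^+ n <= r.
    by case: n => // n _; rewrite exprS ler_piMr // exprn_ile1.
  have a0E : (a o)%:~R = - (y%:~R * x ^+ i) - x ^+ d
       - \sum_(j < d | (j != i) && (j != o)) (a j)%:~R * x ^+ j.
    have := eq0; rewrite (bigD1 o) //= expr0 mulr1 => h.
    by apply/eqP; rewrite -subr_eq0 -[X in _ == X]h; apply/eqP; ring.
  apply: le_trans (_ : normc ((a o)%:~R : R[i]) <= _).
    by rewrite normc_int -[1]/(1%:~R) ler_int; move: a0; rewrite -/o; lia.
  rewrite a0E; apply: le_trans (le_normcD _ _) _; rewrite normcN.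
  apply: le_trans (_ : (y%:R * r ^+ i + r ^+ d) + A * r <= _).
    apply: lerD; last first.
      apply: leA => // j /andP[_ jo]; apply: rXr; rewrite lt0n.
      by apply: contraNneq jo => j0; apply/eqP/val_inj.
    by apply: le_trans (le_normcD _ _) _; rewrite !normcN yE normc_exp.
  by rewrite /L mulrDl mul1r -addrA lerD2l lerD2r rXr.
Qed.

Lemma exists_coef_no_root_product (R : realType) d (d_gt0 : (0 < d)%N)
    (a : 'I_d -> int) (i : 'I_d) k (c : int) :
  (0 < i)%N -> ~~ (d %| k * i)%N -> a (Ordinal d_gt0) != 0 -> c != 0 ->
  exists y : int, forall rs : seq R[i], size rs = k ->
    {in rs, forall x, root (map_poly intr (monic_poly (set_coef a i y))) x} ->
    \prod_(x <- rs) x != c%:~R.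
Proof.
move=> i0 dki a0 c0.
pose L : R := 1 + \sum_(j < d) `|a j|%:~R.
pose C := (2 * L) ^+ d.
pose e := (i * (d - i))%N.
pose B : R := `|c|%:~R ^+ e.
have L1 : 1 <= L by rewrite lerDl; apply: sumr_ge0 => j _; rewrite ler0z.
have C0 : 0 < C by rewrite exprn_gt0 // mulr_gt0 // (lt_le_trans ltr01).
have B1 : 1 <= B by apply: exprn_ege1; rewrite -[1]/(1%:~R) ler_int; move: c0; lia.
have B0 : 0 < B by apply: lt_le_trans B1.
have CB0 : 0 < C ^+ k * B by apply: mulr_gt0 => //; apply: exprn_gt0.
pose y := Num.bound (C ^+ k * B + C).
have yb : C ^+ k * B + C < y%:R.
  by apply: archi_boundP; rewrite addr_ge0 // ltW.
have y1 : C ^+ k * B < y%:R by apply: le_lt_trans yb; rewrite lerDl ltW.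
have y2 : C <= y%:R by apply: le_trans (ltW yb); rewrite lerDr ltW.
have y0 : 0 < y%:R :> R by apply: lt_le_trans y2.
have yge1 : 1 <= y%:R :> R by move: y0; rewrite ltr0n -[1]/(1%:R) ler_nat.
exists y => rs rsk hrs; apply/eqP => rsc.
have id : (i < d)%N := ltn_ord i.
have [|||b|j [l [jl h1 h2]]] := @root_products_ratio R C (y%:R ^+ i) (y%:R ^+ (d - i))
    [seq normc x ^+ e | x <- rs] C0.
- by rewrite exprn_gt0.
- by rewrite exprn_gt0.
- by apply/allP => _ /mapP[x _ ->]; rewrite exprn_ge0 // normc_ge0.
- by move=> /mapP[x xrs ->]; apply: root_set_coef_size (hrs _ xrs) y2.
move: jl h1 h2; rewrite size_map rsk big_map prodrXl -normc_prod rsc normc_int -/B.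
rewrite -![y%:R ^+ _ ^+ _]exprM.
move=> jl h1 h2.
have ne : (i * j <> (d - i) * l)%N.
  move=> E; move/negP: dki; apply; apply/dvdnP; exists l.
  rewrite -jl mulnDl [(j * i)%N]mulnC E [((d - i) * l)%N]mulnC.
  by rewrite -mulnDr subnK // ltnW.
have [lt|lt|//] := ltngtP (i * j)%N ((d - i) * l)%N.
- have : y%:R ^+ ((d - i) * l - i * j) * B <= C ^+ k.
    rewrite -(ler_pM2l (_ : 0 < y%:R ^+ (i * j))) ?exprn_gt0 //.
    by rewrite mulrA -exprD (subnKC (ltnW lt)) [leRHS]mulrC.
  apply/negP; rewrite -ltNge.
  apply: lt_le_trans (_ : y%:R <= _).
    apply: le_lt_trans y1; rewrite -[leLHS]mulr1; apply: ler_wpM2l => //.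
    by apply: exprn_ge0; apply: ltW.
  rewrite -[leLHS]mulr1; apply: ler_pM => //.
  by rewrite -[leLHS]expr1; apply: ler_weXn2l => //; rewrite subn_gt0.
- have : y%:R ^+ (i * j - (d - i) * l) <= C ^+ k * B.
    rewrite -(ler_pM2l (_ : 0 < y%:R ^+ ((d - i) * l))) ?exprn_gt0 //.
    by rewrite -exprD (subnKC (ltnW lt)) mulrCA.
  apply/negP; rewrite -ltNge; apply: lt_le_trans y1 _.
  by rewrite -[leLHS]expr1; apply: ler_weXn2l => //; rewrite subn_gt0.
Qed.

Lemma monic_poly_coef d (c : 'I_d -> int) (i : 'I_d) : (monic_poly c)`_i = c i.
Proof.
rewrite /monic_poly coefD coefXn ltn_eqF ?ltn_ord // add0r coef_sum (bigD1 i) //=.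
rewrite coefZ coefXn eqxx mulr1 big1 ?addr0 // => j ji.
by rewrite coefZ coefXn eq_sym (negbTE (ji : j != i :> nat)) mulr0.
Qed.

Lemma size_monic_poly d (c : 'I_d -> int) : size (monic_poly c) = d.+1.
Proof.
rewrite /monic_poly size_polyDl ?size_polyXn // ltnS.
apply/leq_sizeP => j dj; rewrite coef_sum big1 // => i _.
by rewrite coefZ coefXn gtn_eqF ?mulr0 // (leq_trans _ dj).
Qed.

Lemma monic_poly_monic d (c : 'I_d -> int) : monic_poly c \is monic.
Proof.
rewrite monicE lead_coefE size_monic_poly /= /monic_poly coefD coefXn eqxx.
rewrite coef_sum big1 ?addr0 // => i _.
by rewrite coefZ coefXn gtn_eqF ?mulr0.
Qed.

Lemma monic_split (R : rcfType) (p : {poly int}) : p \is monic ->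
  exists2 rs : seq R[i], size rs = (size p).-1 &
    map_poly intr p = \prod_(z <- rs) ('X - z%:P).
Proof.
move=> pm; have pm' : map_poly intr p \is @monic R[i] by apply: monic_map.
have [rs E] := closed_field_poly_normal (map_poly intr p : {poly R[i]}).
exists rs; last by rewrite [LHS]E (monicP pm') scale1r.
have := congr1 (fun q : {poly _} => size q) E.
rewrite (monicP pm') scale1r size_prod_XsubC size_map_inj_poly ?rmorph0 //.
  by move=> ->.
exact: intr_inj.
Qed.

Lemma card_initial_ords d k : (k <= d)%N -> #|[set j : 'I_d | (j < k)%N]%SET| = k.
Proof.
move=> kd; rewrite cardsE -sum1_card -(big_ord_widen d (fun=> 1%N) kd).
by rewrite sum1_card card_ord.
Qed.

(* [R] only serves to provide a field [R[i]] in which the polynomials split. *)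
Lemma count_coef_with_factor (R : realType) d (d_gt0 : (0 < d)%N)
    (a : 'I_d -> int) (i : 'I_d) k (c : int) (s : seq int) :
  (0 < i)%N -> ~~ (d %| k * i)%N -> a (Ordinal d_gt0) != 0 -> c != 0 ->
  uniq s ->
  {in s, forall y, exists u v : {poly int},
    [/\ u \is monic, size u = k.+1, u`_0 = c &
        monic_poly (set_coef a i y) = u * v]} ->
  (size s <= k * 'C(d, k))%N.
Proof.
move=> i0 dki a0 c0 us hs.
pose c' : int := (-1) ^+ k * c.
have c'0 : c' != 0 by rewrite mulf_neq0 ?signr_eq0.
pose cc (j : 'I_d) : {poly R[i]} := if j == i then 'X else (a j)%:~R%:P.
have [||q qs qE] := @symmetric_root_poly R[i] d
    (subset_prod_mpoly d k c'%:~R) cc.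
- exact: subset_prod_mpoly_sym.
- by move=> j; rewrite /cc; case: ifP => _; rewrite ?size_polyX // size_polyC; case: eqP.
have {}qE y (rs : d.-tuple R[i]) :
    map_poly intr (monic_poly (set_coef a i y)) = \prod_(z <- rs) ('X - z%:P) ->
    \prod_(S : {set 'I_d} | #|S| == k) (c'%:~R - \prod_(j in S) tnth rs j)
      = q.[y%:~R].
  move=> E; rewrite -meval_subset_prod_mpoly; apply: qE => j.
  rewrite -E coef_map /= monic_poly_coef /set_coef /cc.
  by case: ifP => _; rewrite ?hornerX ?hornerC.
have q0 : q != 0.
  apply/eqP => q0; have [y hy] := exists_coef_no_root_product R i0 dki a0 c'0.
  have [rs rss E] := monic_split R (monic_poly_monic (set_coef a i y)).
  rewrite size_monic_poly /= in rss.
  have /eqP := qE y (Tuple (introT eqP rss)) E.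
  rewrite q0 horner0 => /prodf_eq0[S /eqP Sk]; rewrite subr_eq0 => /eqP h.
  have := hy [seq tnth (Tuple (introT eqP rss)) j | j <- enum S].
  rewrite size_map -cardE big_map big_enum /= -h eqxx => /(_ Sk) h'.
  suff : false by []; apply: h' => _ /mapP[j _ ->].
  by rewrite E root_prod_XsubC mem_tnth.
have rootq y : y \in s -> root q y%:~R.
  move=> /hs[u [v [um uk uc E]]].
  have fm := monic_poly_monic (set_coef a i y).
  have vm : v \is monic by move: fm; rewrite E monicMl.
  have [ru rus Eu] := monic_split R um.
  have [rv rvs Ev] := monic_split R vm.
  have rss : size (ru ++ rv) == d.
    have := size_monic_poly (set_coef a i y).
    rewrite E size_cat rus rvs size_monicM ?monic_neq0 // uk /=.
    have : (0 < size v)%N by rewrite lt0n size_poly_eq0 monic_neq0.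
    by case: (size v) => // n _; rewrite addnS => -[->].
  have kd : (k <= d)%N by rewrite -(eqP rss) size_cat rus uk leq_addr.
  rewrite /root -(qE y (Tuple rss)); last first.
    by rewrite E rmorphM /= Eu Ev big_cat.
  apply/prodf_eq0; exists [set j : 'I_d | (j < k)%N]%SET.
    by rewrite card_initial_ords.
  rewrite subr_eq0 /c' -uc rmorphM /= rmorphXn rmorphN rmorph1.
  have -> : (u`_0)%:~R = (map_poly intr u)`_0 :> R[i] by rewrite coef_map.
  rewrite Eu coef0_prod_XsubC rus uk /= mulrA -exprD addnn -mul2n exprM sqrrN.
  rewrite !expr1n mul1r (big_nth 0) rus uk /= big_mkord.
  rewrite (big_ord_widen _ (fun j => ru`_j) kd); apply/eqP.
  apply: eq_big => [j|j jk]; first by rewrite inE.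
  by rewrite (tnth_nth 0) /= nth_cat rus uk jk.
have := @max_poly_roots _ q [seq (y%:~R : R[i]) | y <- s] q0.
rewrite size_map map_inj_uniq => [|x y /intr_inj] //.
move=> /(_ _ us) h; rewrite -ltnS.
have /h {}h : all (root q) [seq (y%:~R : R[i]) | y <- s].
  by apply/allP => _ /mapP[y ys ->]; apply: rootq.
by apply: leq_trans h (leq_trans qs _); apply: msize_subset_prod_mpoly.
Qed.

Lemma reducible_monic_factor d (c : 'I_d -> int) :
  (0 < d)%N -> ~ irreducibleZ (monic_poly c) ->
  exists k (u v : {poly int}),
    [/\ (0 < k < d)%N, u \is monic, size u = k.+1 & monic_poly c = u * v].
Proof.
move=> d_gt0 nirr; have sf := size_monic_poly c; have fm := monic_poly_monic c.
have [g [h [sg sh E]]] : exists g h : {poly int},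
    [/\ (1 < size g)%N, (1 < size h)%N & monic_poly c = g * h].
  by apply: contra_notP nirr => ngh; split => //; rewrite sf.
have lgh : lead_coef g * lead_coef h = 1.
  by rewrite -lead_coefM -E; apply/monicP.
have lg2 : lead_coef g * lead_coef g = 1.
  have /eqP := congr1 absz lgh; rewrite abszM muln_eq1 => /andP[/eqP lg1 _].
  by case: (intP (lead_coef g)) lg1 => // n; rewrite ?abszN => -[->].
have lg0 : lead_coef g != 0 by apply: contra_eq_neq lg2 => ->; rewrite mul0r eq_sym oner_eq0.
have g0 : g != 0 by rewrite -lead_coef_eq0.
have h0 : h != 0 by rewrite -size_poly_eq0 -lt0n ltnW.
exists (size g).-1, (lead_coef g *: g), (lead_coef g *: h); split.
- move: sf; rewrite E size_mul // => sf.
  by move: (size g) (size h) sg sh sf => x y *; lia.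
- by rewrite monicE lead_coefZ lg2.
- by rewrite size_scale // prednK // ltnW.
- by rewrite -scalerAl -scalerAr scalerA lg2 scale1r.
Qed.

Definition has_factor k (f : {poly int}) : Prop :=
  exists u v : {poly int}, [/\ u \is monic, size u = k.+1 & f = u * v].

Lemma leq_size_sum_count (I J : eqType) (s : seq I) (D : seq J)
    (p : J -> pred I) :
  {in s, forall y, has (fun c => p c y) D} ->
  (size s <= \sum_(c <- D) count (p c) s)%N.
Proof.
elim: s => [|y s IH] hs //=.
rewrite big_split /=.
have /IH : {in s, forall y, has (fun c => p c y) D}.
  by move=> x xs; apply: hs; rewrite in_cons xs orbT.
have : (1 <= \sum_(c <- D) p c y)%N.
  have /hasP[c cD pc] := hs y (mem_head _ _).
  by rewrite (big_rem c cD) /= pc.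
by move=> h1 h2; rewrite -add1n leq_add.
Qed.

Lemma count_coef_has_factor (R : realType) d (d_gt0 : (0 < d)%N)
    (a : 'I_d -> int) (i : 'I_d) k (s : seq int) :
  (0 < i)%N -> ~~ (d %| k * i)%N -> a (Ordinal d_gt0) != 0 -> uniq s ->
  {in s, forall y, has_factor k (monic_poly (set_coef a i y))} ->
  (size s <= 2 * tau (a (Ordinal d_gt0)) * (k * 'C(d, k)))%N.
Proof.
set o := Ordinal d_gt0 => i0 dki a0 us hs.
pose D := [seq (m%:Z) | m <- divisors `|a o|] ++
          [seq - (m%:Z) | m <- divisors `|a o|].
have sD : size D = (2 * tau (a o))%N by rewrite size_cat !size_map /tau mul2n addnn.
have DP (c : int) : (`|c| %| `|a o|)%N -> c \in D.
  rewrite dvdn_divisors ?absz_gt0 // => cd; rewrite mem_cat.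
  case: (intP c) cd => [|n|n] cd; apply/orP; [left|left|right].
  - by apply/mapP; exists 0%N.
  - by apply/mapP; exists n.+1.
  - by apply/mapP; exists n.+1 => //; move: cd; rewrite abszN.
have D0 (c : int) : c \in D -> c != 0.
  rewrite mem_cat => /orP[] /mapP[m]; rewrite -dvdn_divisors ?absz_gt0 // => md ->;
  rewrite ?oppr_eq0; apply: contraNneq a0 => -[m0]; move: md; rewrite m0 dvd0n.
    by rewrite absz_eq0.
  by rewrite absz_eq0.
pose p (c y : int) := `[< exists u v : {poly int},
    [/\ u \is monic, size u = k.+1, u`_0 = c &
        monic_poly (set_coef a i y) = u * v] >].
apply: leq_trans (leq_size_sum_count (p := p) (D := D) _) _.
  move=> y /hs[u [v [um uk E]]]; apply/hasP; exists u`_0; last first.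
    by apply/asboolP; exists u, v.
  apply: DP; have := monic_poly_coef (set_coef a i y) o.
  rewrite E coef0M /set_coef ifF => [<-|]; first by rewrite abszM dvdn_mulr.
  by apply/negbTE; apply: contraTneq i0 => <-.
rewrite -sD big_seq -sum1_size big_distrl /= [leqRHS]big_seq.
apply: leq_sum => c cD; rewrite mul1n -size_filter.
apply: (count_coef_with_factor R (d_gt0 := d_gt0) i0 dki a0 (D0 c cD)).
  exact: filter_uniq.
by move=> y; rewrite mem_filter => /andP[/asboolP].
Qed.

Lemma gcdn_family_not_dvdn d k (I0 : {set 'I_d}) :
  gcdn d (\big[gcdn/0%N]_(i in I0) val i) = 1%N -> (0 < k < d)%N ->
  exists2 i, i \in I0 & ~~ (d %| k * i)%N.
Proof.
move=> g1 /andP[k0 kd]; apply/exists_inP; apply: contraLR kd => /exists_inPn h.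
rewrite -leqNgt; apply: dvdn_leq => //.
have cop : coprime d (\big[gcdn/0%N]_(i in I0) val i) by rewrite /coprime g1.
rewrite -(Gauss_dvdl _ cop).
elim/big_rec: _ => [|i x iI0 IH]; first by rewrite muln0 dvdn0.
rewrite muln_gcdr dvdn_gcd IH andbT.
by have := h i iI0; rewrite negbK.
Qed.

Lemma measurable_preimage_countable disp (T : measurableType disp)
    (V : countType) (X : T -> V) (D : set V) :
  (forall v, measurable (X @^-1` [set v])) -> measurable (X @^-1` D).
Proof.
move=> mX.
have -> : X @^-1` D = \bigcup_v (if v \in D then X @^-1` [set v] else set0).
  apply/seteqP; split=> [w Dw|w [v _]].
    by exists (X w) => //; rewrite mem_set.
  by case: ifPn => // /set_mem Dv /= ->.
apply: countable_bigcupT_measurable => [|v]; first exact: countableP.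
by case: ifPn.
Qed.

Lemma le_measure_fibers disp (T : measurableType disp) (R : realType)
    (P : {measure set T -> \bar R}) (V : countType) (X : T -> V)
    (B : set T) (g : T -> \bar R) :
  (forall v, measurable (X @^-1` [set v])) -> measurable B ->
  measurable_fun setT g -> (forall w, (0 <= g w)%E) ->
  (forall v, (P (B `&` X @^-1` [set v]) <= \int[P]_(w in X @^-1` [set v]) g w)%E) ->
  (P B <= \int[P]_w g w)%E.
Proof.
move=> mX mB mg g0 h.
pose F (n : nat) := X @^-1` [set v : V | choice.pickle v = n].
have mF n : measurable (F n) by apply: measurable_preimage_countable.
have tF : trivIset setT F.
  by move=> m n _ _ [w [/= <- <-]].
have UF : \bigcup_n F n = setT.
  by apply/seteqP; split=> // w _; exists (choice.pickle (X w)).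
have -> : P B = (\sum_(n <oo) P (B `&` F n))%E.
  rewrite -[in LHS](setIT B) -UF setI_bigcupr measure_semi_bigcup //.
  - by move=> n; apply: measurableI.
  - exact: trivIset_setIl.
  - by apply: bigcup_measurable => n _; apply: measurableI.
rewrite -UF ge0_integral_bigcup //; last by rewrite UF.
apply: lee_nneseries => [n _ _|n _]; first exact: measure_ge0.
have [[v vn]|nv] := pselect (exists v : V, choice.pickle v = n).
  have -> : F n = X @^-1` [set v].
    apply/seteqP; split=> w /=; last by rewrite /F /= => ->.
    by rewrite /F /= -vn => /(pcan_inj choice.pickleK).
  exact: h.
have -> : F n = set0.
  by apply/seteqP; split=> // w; rewrite /F /= => wn; apply: nv; exists (X w).
by rewrite setI0 measure0 integral_set0.
Qed.

Lemma measurable_mfun_preimage disp (T : measurableType disp)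
    (X : {mfun T >-> int}) (B : set int) :
  measurable (X @^-1` B).
Proof. by rewrite -[X in measurable X]setTI; apply: measurable_funPT. Qed.

Lemma le_measure_bigsetU disp (T : measurableType disp) (R : realType)
    (P : {measure set T -> \bar R}) (I : Type) (s : seq I) (F : I -> set T) :
  (forall i, measurable (F i)) ->
  (P (\big[setU/set0]_(i <- s) F i) <= \sum_(i <- s) P (F i))%E.
Proof.
move=> mF; elim: s => [|i s IH]; first by rewrite !big_nil measure0.
rewrite !big_cons; apply: le_trans (measureU2 _ _ _) _ => //.
  exact: bigsetU_measurable.
by apply: leeD2l.
Qed.

Lemma uniform_prob_seq disp (T : measurableType disp) (R : realType)
    (P : probability T R) (S : {fset int}) (X : {RV P >-> int}) (s : seq int) :
  uniform_on S X -> uniq s -> {subset s <= S} ->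
  P (X @^-1` [set` s]) = ((size s)%:R / #|` S|%:R)%:E.
Proof.
move=> uX; elim: s => [|y s IH] /=.
  move=> _ _; rewrite mul0r (_ : X @^-1` _ = set0) ?measure0 //.
  by apply/seteqP; split.
move=> /andP[ys us] sS.
have -> : X @^-1` [set` y :: s] = X @^-1` [set y] `|` X @^-1` [set` s].
  apply/seteqP; split=> w /=; rewrite in_cons.
    by move=> /orP[/eqP|]; [left|right].
  by move=> [->|->]; rewrite ?eqxx ?orbT.
rewrite measureU; first last.
- apply/seteqP; split=> // w /= [Xy]; rewrite Xy => ys'.
  by rewrite ys' in ys.
- exact: measurable_mfun_preimage.
- exact: measurable_mfun_preimage.
have := uX y; rewrite sS ?mem_head // => uXy.
transitivity (distribution P X [set y] + P (X @^-1` [set` s]))%E; first by [].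
rewrite uXy IH // => [|x xs]; last by apply: sS; rewrite in_cons xs orbT.
by rewrite -EFinD -[X in X + _]mul1r -mulrDl -natr1 addrC.
Qed.

Lemma mutually_independent_coord disp (T : measurableType disp)
    (R : realType) (P : probability T R) (I : finType)
    (X : I -> {RV P >-> int}) (i : I) (B : I -> set int) (C : set int) :
  mutually_independent X ->
  P ((\bigcap_(j in [set` [set~ i]%SET]) X j @^-1` B j) `&` X i @^-1` C)
  = (P (\bigcap_(j in [set` [set~ i]%SET]) X j @^-1` B j) * P (X i @^-1` C))%E.
Proof.
move=> indep; pose B' j := if j == i then C else B j.
rewrite (indep [set~ i]%SET) //.
have -> : (\bigcap_(j in [set` [set~ i]%SET]) X j @^-1` B j) `&` X i @^-1` C
    = \bigcap_(j in [set` [set: I]%SET]) X j @^-1` B' j.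
  apply/seteqP; split=> w.
    move=> [hw hC] j _; rewrite /B'; case: eqP => [->//|ji] /=.
    by apply: hw; rewrite /= !inE; apply/eqP.
  move=> hw; split=> [j /=|]; last first.
    by have := hw i; rewrite /B' eqxx; apply; rewrite /= inE.
  rewrite !inE => ji; have := hw j; rewrite /B' (negbTE ji); apply.
  by rewrite /= inE.
rewrite (indep [set: I]%SET) // (bigD1 i) ?inE //= muleC; congr (_ * _)%E.
  apply: eq_big => [j|j]; rewrite !inE // => ji.
  by rewrite /B' (negbTE ji).
by rewrite /B' eqxx.
Qed.

Lemma measurable_coef_event disp (T : measurableType disp) (I : finType)
    (X : I -> {mfun T >-> int}) (D : (I -> int) -> Prop) :
  measurable [set w | D (fun i => X i w)].
Proof.
pose W w : {ffun I -> int} := [ffun i => X i w].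
have -> : [set w | D (fun i => X i w)] = W @^-1` [set v : {ffun I -> int} | D v].
  apply/seteqP; split=> w /=; rewrite (_ : (W w : I -> int) = fun i => X i w) //;
  by apply/funext => i; rewrite ffunE.
apply: measurable_preimage_countable => v.
have -> : W @^-1` [set v] = \bigcap_(i in [set` [set: I]%SET]) X i @^-1` [set v i].
  apply/seteqP; split=> w /=; first by move=> <- i _; rewrite /= ffunE.
  by move=> h; apply/ffunP => i; rewrite ffunE; apply: (h i); rewrite /= inE.
apply: fin_bigcap_measurable => // i _; exact: measurable_mfun_preimage.
Qed.

Lemma uniform_prob_notin disp (T : measurableType disp) (R : realType)
    (P : probability T R) (S : {fset int}) (X : {RV P >-> int}) :
  uniform_on S X -> (0 < #|` S|)%N -> P (X @^-1` (~` [set` S])) = 0%E.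
Proof.
move=> uX S0; rewrite preimage_setC probability_setC; last first.
  exact: (measurable_mfun_preimage X [set` S]).
rewrite (uniform_prob_seq (s := enum_fset S) uX) ?fset_uniq //.
by rewrite divff ?subee // pnatr_eq0 -lt0n.
Qed.

Lemma prob_has_factor_le (R : realType) disp (T : measurableType disp)
    (P : probability T R) d (d_gt0 : (0 < d)%N) H (H_gt0 : (0 < H)%N)
    (a : 'I_d -> {RV P >-> int}) (i : 'I_d) k :
  let o := Ordinal d_gt0 in
  mutually_independent a -> uniform_on_large_set H (a i) ->
  (0 < i)%N -> ~~ (d %| k * i)%N ->
  (P [set w | a o w <> 0%R /\ has_factor k (monic_poly (fun j => a j w))] <=
   ((2 * (k * 'C(d, k)))%N%:R / H%:R)%:E *
   'E_P[(fun w => (tau (a o w))%:R * \1_[set v | a o v <> 0] w)%R])%E.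
Proof.
move=> o indep [S HS uS] i0 dki.
have S0 : (0 < #|` S|)%N by apply: leq_trans HS.
set c : R := _ / _; have c0 : 0 <= c by rewrite divr_ge0.
pose t (n : int) : R := (tau n)%:R * (n != 0)%:R.
have tE w : (tau (a o w))%:R * \1_[set v | a o v <> 0] w = t (a o w).
  rewrite /t indicE; congr (_ * (nat_of_bool _)%:R).
  by apply/idP/idP => [/set_mem/eqP|/eqP ao]; last exact/mem_set.
have t0 n : 0 <= t n by rewrite mulr_ge0.
rewrite unlock; under eq_integral => w _ do rewrite tE.
have mt : measurable_fun setT (fun w => (t (a o w))%:E).
  apply/measurable_EFinP.
  have mt' : measurable_fun setT t by [].
  exact: measurableT_comp.
rewrite -ge0_integralZl_EFin //; last by move=> w _; rewrite lee_fin.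
pose W w : {ffun 'I_d -> int} := [ffun j => if j == i then 0 else a j w].
have io : o != i by apply: contraTneq i0 => <-.
have fib (v : {ffun 'I_d -> int}) : v i = 0 ->
    W @^-1` [set v] = \bigcap_(j in [set` [set~ i]%SET]) a j @^-1` [set v j].
  move=> vi; apply/seteqP; split=> w /=.
    by move=> <- j; rewrite /= !inE ffunE => /negbTE ->.
  move=> h; apply/ffunP => j; rewrite ffunE; case: eqP => [->//|/eqP ji].
  by apply: (h j); rewrite /= !inE.
have fib0 (v : {ffun 'I_d -> int}) : v i != 0 -> W @^-1` [set v] = set0.
  move=> vi; apply/seteqP; split=> // w /= Wv; move: vi.
  by rewrite -Wv ffunE eqxx.
have mfib (v : {ffun 'I_d -> int}) : measurable (W @^-1` [set v]).
  have [vi|vi] := eqVneq (v i) 0; last by rewrite fib0.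
  by rewrite fib //; apply: fin_bigcap_measurable => // j _; apply: measurable_mfun_preimage.
apply: (le_measure_fibers (X := W)) => //.
- exact: (@measurable_coef_event _ _ _ a
    (fun v => v o <> 0 /\ has_factor k (monic_poly v))).
- exact: measurable_funeM.
- by move=> w; rewrite mule_ge0 // lee_fin.
move=> v; have [vi|vi] := eqVneq (v i) 0; last first.
  by rewrite fib0 // setI0 measure0 integral_set0.
set F := W @^-1` [set v]; set B := [set w | _].
have Fo w : F w -> a o w = v o.
  by move=> /= <-; rewrite ffunE (negbTE io).
have [vo|vo] := eqVneq (v o) 0.
  have -> : B `&` F = set0.
    by apply/seteqP; split=> // w [[ao _] /Fo]; rewrite vo.
  by rewrite measure0; apply: integral_ge0 => w _; rewrite mule_ge0 // lee_fin.
have -> : (\int[P]_(w in F) (c%:E * (t (a o w))%:E) = (c * t (v o))%:E * P F)%E.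
  rewrite -integral_cst //; last exact: mfib.
  by apply: eq_integral => w /set_mem /Fo ->.
pose s := [seq y <- enum_fset S | `[< has_factor k (monic_poly (set_coef v i y)) >]].
have us : uniq s by rewrite filter_uniq // fset_uniq.
have sS : {subset s <= S} by move=> y; rewrite mem_filter => /andP[].
have ss : (size s <= 2 * tau (v o) * (k * 'C(d, k)))%N.
  apply: (count_coef_has_factor R i0 dki vo us) => y.
  by rewrite mem_filter => /andP[/asboolP].
have BF : B `&` F `<=` (F `&` a i @^-1` [set` s]) `|` a i @^-1` (~` [set` S]).
  move=> w [[_ Bw] Fw]; have [aS|aS] := boolP (a i w \in S); last by right; apply/negP.
  left; split=> //=; rewrite mem_filter aS andbT; apply/asboolP.
  rewrite (_ : set_coef v i (a i w) = fun j => a j w) //.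
  apply/funext => j; rewrite /set_coef; case: eqP => [->//|/eqP ji].
  by rewrite -(Fw : W w = v) ffunE (negbTE ji).
have mi Y : measurable (a i @^-1` Y) by apply: measurable_mfun_preimage.
have mF : measurable F by apply: mfib.
apply: le_trans (le_measure P _ _ BF) _; rewrite ?inE.
- apply: measurableI => //; exact: (@measurable_coef_event _ _ _ a
    (fun v => v o <> 0 /\ has_factor k (monic_poly v))).
- by apply: measurableU => //; apply: measurableI.
apply: le_trans (measureU2 _ _ _) _ => //; first exact: measurableI.
rewrite [X in (_ + X <= _)%E](uniform_prob_notin uS S0) adde0.
have PF : P (F `&` a i @^-1` [set` s]) = (P F * P (a i @^-1` [set` s]))%E.
  by rewrite /F fib //; apply: (mutually_independent_coord i (fun j => [set v j])).
rewrite [X in (X <= _)%E]PF (uniform_prob_seq uS us sS) muleC.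
rewrite lee_wpmul2r // lee_fin /c /t vo mulr1.
rewrite mulrAC -natrM; apply: ler_pM => //; rewrite ?invr_ge0 //.
  by rewrite ler_nat; move: ss; rewrite mulnAC.
by rewrite lef_pV2 ?posrE ?ltr0n // ler_nat.
Qed.

Lemma prob_irreducible_ge (R : realType) disp (T : measurableType disp)
    (P : probability T R) d (d_gt0 : (0 < d)%N) H (H_gt0 : (0 < H)%N)
    (a : 'I_d -> {RV P >-> int}) (I0 : {set 'I_d}) :
  let o := Ordinal d_gt0 in
  mutually_independent a ->
  (forall i, i \in I0 -> (0 < i)%N) ->
  gcdn d (\big[gcdn/0%N]_(i in I0) val i) = 1%N ->
  (forall i, i \in I0 -> uniform_on_large_set H (a i)) ->
  (P [set w | irreducibleZ (monic_poly (fun i => a i w))] >=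
   1 - P [set w | a o w = 0%R] - ((2 * d * 2 ^ d)%N%:R / H%:R)%:E *
   'E_P[(fun w => (tau (a o w))%:R * \1_[set v | a o v <> 0] w)%R])%E.
Proof.
move=> o indep I0_gt0 gcd1 unif.
set E := 'E_P[_]%E.
have E0 : (0 <= E)%E by apply: expectation_ge0 => w; rewrite mulr_ge0.
pose B (k : 'I_d) := [set w | (0 < k)%N /\
  (a o w <> 0 /\ has_factor k (monic_poly (fun j => a j w)))].
have mevent D : measurable [set w | D (fun i => a i w)].
  exact: measurable_coef_event.
have mB k : measurable (B k).
  exact: (mevent (fun v => (0 < k)%N /\ (v o <> 0 /\ has_factor k (monic_poly v)))).
have PB k : (P (B k) <= ((2 * (d * 'C(d, k)))%N%:R / H%:R)%:E * E)%E.
  have [k0|k0] := posnP k.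
    rewrite (_ : B k = set0) ?measure0; first by rewrite mule_ge0 // lee_fin divr_ge0.
    by apply/seteqP; split=> // w [/=]; rewrite k0.
  have [i iI0 dki] : exists2 i, i \in I0 & ~~ (d %| k * i)%N.
    by apply: gcdn_family_not_dvdn gcd1 _; rewrite k0 ltn_ord.
  have := prob_has_factor_le d_gt0 H_gt0 indep (unif i iI0) (I0_gt0 i iI0) dki.
  rewrite -/o -/E => h; apply: le_trans (le_trans h _).
    apply: le_measure; rewrite ?inE //; last by move=> w [].
    exact: (mevent (fun v => v o <> 0 /\ has_factor k (monic_poly v))).
  rewrite lee_wpmul2r // lee_fin ler_wpM2r ?invr_ge0 // ler_nat.
  by rewrite leq_mul2l leq_mul2r (ltnW (ltn_ord k)) !orbT.
set Irr := [set w | irreducibleZ _]; set Z := [set w | a o w = 0%R].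
have mIrr : measurable Irr := mevent (fun v => irreducibleZ (monic_poly v)).
have mZ : measurable Z := mevent (fun v => v o = 0).
have cover : ~` Irr `<=` Z `|` \big[setU/set0]_(k < d) B k.
  move=> w nirr; have [aw|/eqP aw] := eqVneq (a o w) 0; [by left|right].
  have [k [u [v [/andP[k0 kd] um uk fE]]]] := reducible_monic_factor d_gt0 nirr.
  rewrite (bigD1 (Ordinal kd)) //=; left; split=> //; split=> //.
  by exists u, v.
have sumB : (\sum_(k < d) P (B k) <= ((2 * d * 2 ^ d)%N%:R / H%:R)%:E * E)%E.
  apply: le_trans (lee_sum _ (fun k _ => PB k)) _.
  rewrite -ge0_sume_distrl => [|k _]; last by rewrite lee_fin divr_ge0.
  rewrite lee_wpmul2r // sumEFin lee_fin -mulr_suml ler_wpM2r ?invr_ge0 //.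
  rewrite -natr_sum ler_nat -big_distrr -big_distrr /= mulnA leq_mul2l.
  apply/orP; right; have := expnDn 1 1 d; rewrite addn1 => ->.
  rewrite big_ord_recr /=; apply: leq_trans (leq_addr _ _).
  by apply: leq_sum => k _; rewrite !exp1n !muln1.
have : (P (~` Irr) <= P Z + ((2 * d * 2 ^ d)%N%:R / H%:R)%:E * E)%E.
  apply: le_trans (le_measure P _ _ cover) _; rewrite ?inE.
  - exact: measurableC.
  - by apply: measurableU => //; apply: bigsetU_measurable.
  apply: le_trans (measureU2 _ _ _) _ => //; first exact: bigsetU_measurable.
  by apply: leeD2l; apply: le_trans sumB; apply: le_measure_bigsetU.
rewrite probability_setC //.
have : (0 <= ((2 * d * 2 ^ d)%N%:R / H%:R)%:E * E)%E.
  by rewrite mule_ge0 // lee_fin divr_ge0.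
rewrite -(fineK (fin_num_measure P _ mIrr)) -(fineK (fin_num_measure P _ mZ)).
move: (fine (P Irr)) (fine (P Z)) (_ * E)%E => p z [x| |] // _.
  by rewrite -!EFinB -EFinD !lee_fin; lra.
by move=> _; rewrite /= leNye.
Qed.

Theorem theorem1p2 (R : realType) (disp : measure_display)
    (T : measurableType disp) (P : probability T R)
    (d : nat) (d_gt0 : (0 < d)%N) (H : nat) (H_gt0 : (0 < H)%N)
    (a : 'I_d -> {RV P >-> int}) (a_indep : mutually_independent a) :
  let a0 : T -> int := a (Ordinal d_gt0) in
  let f (w : T) : {poly int} := monic_poly (fun i : 'I_d => a i w) in
  let tau_a0 : T -> R :=
    fun w => (tau (a0 w))%:R * \1_[set v | a0 v <> 0] w in
  let conclusion : Prop :=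
    (P [set w | irreducibleZ (f w)] >=
       1 - P [set w | a0 w = 0%R]
         - ((2 * d * 2 ^ d)%N%:R / H%:R)%:E
           * 'E_P[tau_a0])%E in
  (forall h : 'I_d, (0 < h)%N -> coprime h d ->
     uniform_on_large_set H (a h) -> conclusion)
  /\
  (forall I0 : {set 'I_d}, (forall i, i \in I0 -> (0 < i)%N) ->
     gcdn d (\big[gcdn/0%N]_(i in I0) val i) = 1%N ->
     (forall i, i \in I0 -> uniform_on_large_set H (a i)) -> conclusion).
Proof.
move=> a0 f tau_a0 conclusion.
have part2 I0 := @prob_irreducible_ge R disp T P d d_gt0 H H_gt0 a I0 a_indep.
split=> [h h0 hd uh|]; last exact: part2.
apply: (part2 [set h]%SET) => [i||i]; rewrite ?inE.
- by move=> /eqP ->.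
- by rewrite big_set1 gcdnC; apply/eqP.
- by move=> /eqP ->.
Qed.
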